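(* Let $\mathcal{R}_0$ be a TRS and let $\varphi$ (a predicate on TRSs) and $\Phi$ (a predicate on pairs of terms) be such that every TRS $\mathcal{S}$ satisfying $\varphi(\mathcal{S})$ and $\Phi(u,v)$ for all critical pairs $\langle u,v\rangle$ of $\mathcal{S}$ is confluent. Run the UNC completion procedure on input $\mathcal{R}_0,\varphi,\Phi$. If it returns UNC then $\mathcal{R}_0$ has UNC, and if it returns NotUNC then $\mathcal{R}_0$ does not have UNC.
   Context: A TRS is a finite set of rewrite rules $l\to r$ ($l\notin\mathcal{V}$, $\mathcal{V}(r)\subseteq\mathcal{V}(l)$); $\mathrm{NF}(\mathcal{R})$ is its set of normal forms, and $\mathcal{R}$ has UNC if any two convertible normal forms are equal. Critical pairs: for rules $l_1\to r_1$, $l_2\to r_2$ renamed apart and a non-variable position $p$ of $l_2$ with $\sigma=\mathrm{mgu}(l_1,l_2|_p)$ (excluding $p=\epsilon$ with identical rules), $\langle l_2[r_1]_p\sigma,r_2\sigma\rangle$ is a critical pair; $\mathrm{CP}(\mathcal{R})$ is the set of them. UNC completion procedure (input $\mathcal{R},\varphi,\Phi$; output UNC, NotUNC, Failure, or nontermination). Step 1: compute $\mathrm{CP}(\mathcal{R})$. Step 2: if $\Phi(u,v)$ for all $\langle u,v\rangle\in\mathrm{CP}(\mathcal{R})$ and $\varphi(\mathcal{R})$, return UNC. Step 3: set $\mathcal{S}:=\emptyset$; for each $\langle u,v\rangle\in\mathrm{CP}(\mathcal{R})$ with $u\ne v$ and $\neg\Phi(u,v)$: (a) if $u,v\in\mathrm{NF}(\mathcal{R})$,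 exit with NotUNC; (b) if $u\notin\mathrm{NF}(\mathcal{R})$ and $v\in\mathrm{NF}(\mathcal{R})$: if $\mathcal{V}(v)\not\subseteq\mathcal{V}(u)$ exit with NotUNC, otherwise $\mathcal{S}:=\mathcal{S}\cup\{u\to v\}$; (c) symmetrically, if $v\notin\mathrm{NF}(\mathcal{R})$ and $u\in\mathrm{NF}(\mathcal{R})$: if $\mathcal{V}(u)\not\subseteq\mathcal{V}(v)$ exit with NotUNC, otherwise $\mathcal{S}:=\mathcal{S}\cup\{v\to u\}$; (d) if $u,v\notin\mathrm{NF}(\mathcal{R})$, try to find a term $w$ with either $u\stackrel{*}{\to}_{\mathcal{R}}w$ and $\mathcal{V}(w)\subseteq\mathcal{V}(v)$, in which case $\mathcal{S}:=\mathcal{S}\cup\{v\to w\}$, or $v\stackrel{*}{\to}_{\mathcal{R}}w$ and $\mathcal{V}(w)\subseteq\mathcal{V}(u)$, in which case $\mathcal{S}:=\mathcal{S}\cup\{u\to w\}$ (if no such $w$ is found, nothing is added). Step 4: if $\mathcal{S}=\emptyset$ return Failure; otherwise set $\mathcal{R}:=\mathcal{R}\cup\mathcal{S}$ and go to Step 1. *)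

(* Defs.v *)
From Stdlib Require Import Relations.
From mathcomp Require Import all_boot.
From mathcomp Require Import boolp classical_sets cardinality.

Set Implicit Arguments.
Unset Strict Implicit.
Unset Printing Implicit Defensive.

Local Open Scope classical_set_scope.

Section Terms.
Variables (F : Type) (ar : F -> nat) (V : Type).

Inductive term : Type :=
| Var of V
| App (f : F) of ('I_(ar f) -> term).

Definition is_var (t : term) : bool := if t is Var _ then true else false.

Fixpoint vars (t : term) : set V :=
  match t with
  | Var x => [set x]
  | App f ts => \bigcup_j vars (ts j)
  end.

Definition substitution := V -> term.

Fixpoint subst (s : substitution) (t : term) : term :=
  match t with
  | Var x => s x
  | App f ts => App (fun j => subst s (ts j))
  end.

Definition rename (rho : V -> V) : term -> term := subst (fun x => Var (rho x)).

(* Positions are sequences of argument indices counted from 0; [subterm_at t p]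
   is [None] when p is not a position of t. *)
Fixpoint subterm_at (t : term) (p : seq nat) : option term :=
  match p, t with
  | [::], _ => Some t
  | i :: q, App f ts => obind (fun j => subterm_at (ts j) q) (insub i)
  | _ :: _, Var _ => None
  end.

(* t is left unchanged when p is not one of its positions. *)
Fixpoint replace_at (t : term) (p : seq nat) (s : term) : term :=
  match p, t with
  | [::], _ => s
  | i :: q, App f ts =>
      App (fun j => if val j == i then replace_at (ts j) q s else ts j)
  | _ :: _, Var _ => t
  end.

Definition rule : Type := (term * term)%type.

Definition is_trs (R : set rule) : Prop :=
  finite_set R /\
  forall l r, R (l, r) -> ~~ is_var l /\ vars r `<=` vars l.

Definition rewrite (R : set rule) (s t : term) : Prop :=
  exists p l r sigma,
    [/\ R (l, r), subterm_at s p = Some (subst sigma l)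
      & t = replace_at s p (subst sigma r)].

Definition rewrites (R : set rule) : term -> term -> Prop :=
  clos_refl_trans term (rewrite R).

Definition convertible (R : set rule) : term -> term -> Prop :=
  clos_refl_sym_trans term (rewrite R).

Definition NF (R : set rule) : set term :=
  [set t | ~ exists t', rewrite R t t'].

Definition UNC (R : set rule) : Prop :=
  forall u v, NF R u -> NF R v -> convertible R u v -> u = v.

Definition confluent (R : set rule) : Prop :=
  forall s t1 t2, rewrites R s t1 -> rewrites R s t2 ->
    exists2 t, rewrites R t1 t & rewrites R t2 t.

Definition unifies (sigma : substitution) (s t : term) : Prop :=
  subst sigma s = subst sigma t.

Definition is_mgu (sigma : substitution) (s t : term) : Prop :=
  unifies sigma s t /\
  forall tau, unifies tau s t ->
    exists delta, forall x, tau x = subst delta (sigma x).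

(* The rules (l1, r1) and (l2, r2) are taken from R itself and then renamed
   apart by rho1 and rho2, so that "identical rules" means that the two elements
   of R coincide.  All choices of the renamings and of the mgu are allowed, so
   this set contains each critical pair in all its variants. *)
Definition critical_pair (R : set rule) : set (term * term) :=
  [set c | exists l1 r1 l2 r2 rho1 rho2 p s sigma,
    [/\ R (l1, r1), R (l2, r2), bijective rho1 & bijective rho2] /\
    [/\ vars (rename rho1 l1) `&` vars (rename rho2 l2) = set0,
        subterm_at (rename rho2 l2) p = Some s,
        ~~ is_var s,
        ~ (p = [::] /\ (l1, r1) = (l2, r2)) &
        is_mgu sigma (rename rho1 l1) s] /\
    c = (subst sigma (replace_at (rename rho2 l2) p (rename rho1 r1)),
         subst sigma (rename rho2 r2))].

Definition variant (c d : term * term) : Prop :=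
  exists2 rho : V -> V, bijective rho
    & d = (rename rho c.1, rename rho c.2).

(* Critical pairs are determined only up to variable renaming.  A map CP is a
   way of computing them when, for every TRS R, it returns a finite set of
   critical pairs of R in which every critical pair of R has a variant. *)
Definition computes_critical_pairs (CP : set rule -> set (term * term)) : Prop :=
  forall R, is_trs R ->
    [/\ finite_set (CP R), CP R `<=` critical_pair R
      & forall c, critical_pair R c -> exists2 d, CP R d & variant c d].

Section Procedure.
Variables (CP : set rule -> set (term * term)).
Variables (phi : set rule -> Prop) (Phi : term -> term -> Prop).

Inductive outcome := ReturnUNC | ReturnNotUNC | ReturnFailure.

Definition success (R : set rule) : Prop :=
  (forall u v, CP R (u, v) -> Phi u v) /\ phi R.

(* Treatment of one critical pair: [None] means "exit with NotUNC", and
   [Some A] means that the rules in A are added to S.  The search for w in the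
   case where neither side is normal is nondeterministic and may always fail. *)
Inductive process (R : set rule) (u v : term) : option (set rule) -> Prop :=
| process_skip :
    u = v \/ Phi u v -> process R u v (Some set0)
| process_normal :
    u <> v -> ~ Phi u v -> NF R u -> NF R v ->
    process R u v None
| process_right_exit :
    u <> v -> ~ Phi u v -> ~ NF R u -> NF R v ->
    ~ (vars v `<=` vars u) -> process R u v None
| process_right_add :
    u <> v -> ~ Phi u v -> ~ NF R u -> NF R v ->
    vars v `<=` vars u -> process R u v (Some [set (u, v)])
| process_left_exit :
    u <> v -> ~ Phi u v -> ~ NF R v -> NF R u ->
    ~ (vars u `<=` vars v) -> process R u v None
| process_left_add :
    u <> v -> ~ Phi u v -> ~ NF R v -> NF R u ->
    vars u `<=` vars v -> process R u v (Some [set (v, u)])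
| process_found_from_left w :
    u <> v -> ~ Phi u v -> ~ NF R u -> ~ NF R v ->
    rewrites R u w -> vars w `<=` vars v -> process R u v (Some [set (v, w)])
| process_found_from_right w :
    u <> v -> ~ Phi u v -> ~ NF R u -> ~ NF R v ->
    rewrites R v w -> vars w `<=` vars u -> process R u v (Some [set (u, w)])
| process_not_found :
    u <> v -> ~ Phi u v -> ~ NF R u -> ~ NF R v ->
    process R u v (Some set0).

(* [loop R C S res]: with the pairs of C still to be treated (in any order) and
   the rules of S accumulated so far, the loop ends with res, where [None] again
   means "exit with NotUNC" and [Some S'] gives the final value of S. *)
Inductive loop (R : set rule) :
  set (term * term) -> set rule -> option (set rule) -> Prop :=
| loop_done S : loop R set0 S (Some S)
| loop_exit C S u v :
    C (u, v) -> process R u v None -> loop R C S None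
| loop_add C S u v A res :
    C (u, v) -> process R u v (Some A) ->
    loop R (C `\ (u, v)) (S `|` A) res -> loop R C S res.

(* [returns R o]: some terminating run of the procedure from R outputs o. *)
Inductive returns : set rule -> outcome -> Prop :=
| returns_UNC R : success R -> returns R ReturnUNC
| returns_NotUNC R :
    ~ success R -> loop R (CP R) set0 None -> returns R ReturnNotUNC
| returns_Failure R :
    ~ success R -> loop R (CP R) set0 (Some set0) -> returns R ReturnFailure
| returns_again R S o :
    ~ success R -> loop R (CP R) set0 (Some S) -> S <> set0 ->
    returns (R `|` S) o -> returns R o.

End Procedure.
End Terms.

(* Main.v *)
(* A completed system has the same normal forms and the same convertibility
   relation as the input: every added rule joins two convertible terms and has a
   reducible left-hand side.  Hence UNC of the input and of the current system
   are equivalent.  Confluence gives UNC.  In the NotUNC exits where a normal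
   form [v] is convertible to a term [u] lacking a variable [x] of [v], exchanging
   [x] with a fresh variable fixes [u], so [v] is convertible to a renaming of
   itself that is a different normal form. *)
Require Import Defs.
From Stdlib Require Import Relations.
From mathcomp Require Import all_boot.
From mathcomp Require Import boolp classical_sets cardinality.

Local Open Scope classical_set_scope.

Section TermRewriting.
Context {F : Type} {ar : F -> nat} {V : Type}.
Implicit Types (s t u v : term ar V) (p q : seq nat) (R S : set (rule ar V)).
Implicit Types (sigma tau : substitution ar V).

(** * Substitutions, variables and positions *)

Lemma subst_comp sigma tau t :
  subst sigma (subst tau t) = subst (fun x => subst sigma (tau x)) t.
Proof. by elim: t => [//|f ts IH] /=; congr App; apply: funext => j. Qed.

Lemma subst_Var t : subst (fun x => Var ar x) t = t.
Proof. by elim: t => [//|f ts IH] /=; congr App; apply: funext => j. Qed.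

Lemma eq_in_subst sigma tau t :
  (forall x, vars t x -> sigma x = tau x) -> subst sigma t = subst tau t.
Proof.
elim: t => [x|f ts IH] /= eq_st; first exact: eq_st.
by congr App; apply: funext => j; apply: IH => x xj; apply: eq_st; exists j.
Qed.

Lemma renameK (rho rho' : V -> V) :
  cancel rho rho' -> cancel (@rename F ar V rho) (rename rho').
Proof.
move=> rhoK t; rewrite /rename subst_comp -[RHS]subst_Var.
by apply: eq_in_subst => x _ /=; rewrite rhoK.
Qed.

Lemma vars_rename (rho : V -> V) t : vars (rename rho t) = rho @` vars t.
Proof.
elim: t => [x|f ts IH] /=; first by rewrite image_set1.
rewrite image_bigcup; apply: eq_bigcupr => j _; exact: IH.
Qed.

Lemma finite_vars t : finite_set (vars t).
Proof.
elim: t => [x|f ts IH] /=; first exact: finite_set1.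
by apply: bigcup_finite => [|j _]; [exact: finite_finset|exact: IH].
Qed.

Lemma subterm_at_nil t : subterm_at t [::] = Some t.
Proof. by case: t. Qed.

Lemma replace_at_nil t s : replace_at t [::] s = s.
Proof. by case: t. Qed.

Lemma subterm_at_subst sigma t p s : subterm_at t p = Some s ->
  subterm_at (subst sigma t) p = Some (subst sigma s).
Proof.
elim: p t => [t|i p IH [x|f ts]] //=.
  by rewrite !subterm_at_nil => -[->].
by case: (insubP 'I_(ar f) i) => [j _ _|//] /=; apply: IH.
Qed.

Lemma subst_replace_at sigma t p s u : subterm_at t p = Some s ->
  subst sigma (replace_at t p u) = replace_at (subst sigma t) p (subst sigma u).
Proof.
elim: p t => [t|i p IH [x|f ts]] //=; first by rewrite !replace_at_nil.
case: (insubP 'I_(ar f) i) => [j _ ij|//] /= /IH E; congr App; apply: funext => k.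
case: eqP => // ki; have -> // : k = j by apply: val_inj; rewrite ij.
Qed.

(** Together with the next lemma, this lifts a rewrite step at position [q] of [u] to one at
    [p ++ q] of the surrounding term. *)
Lemma subterm_at_replace_at_cat t p s u q : subterm_at t p = Some s ->
  subterm_at (replace_at t p u) (p ++ q) = subterm_at u q.
Proof.
elim: p t => [t|i p IH [x|f ts]] //=; first by rewrite !replace_at_nil.
by case: (insubP 'I_(ar f) i) => [j _ <-|//] /= /IH; rewrite eqxx.
Qed.

Lemma replace_at_replace_at_cat t p s u q v : subterm_at t p = Some s ->
  replace_at (replace_at t p u) (p ++ q) v = replace_at t p (replace_at u q v).
Proof.
elim: p t => [t|i p IH [x|f ts]] //=; first by rewrite !replace_at_nil.
case: (insubP 'I_(ar f) i) => [j _ ij|//] /= /IH E; congr App; apply: funext => k.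
case: eqP => // ki; have -> // : k = j by apply: val_inj; rewrite ij.
Qed.

Lemma replace_at_id t p s : subterm_at t p = Some s -> replace_at t p s = t.
Proof.
elim: p t => [t|i p IH [x|f ts]] //=.
  by rewrite subterm_at_nil replace_at_nil => -[].
case: (insubP 'I_(ar f) i) => [j _ ij|//] /= /IH E; congr App; apply: funext => k.
case: eqP => // ki; have -> // : k = j by apply: val_inj; rewrite ij.
Qed.

(** * Closure of rewriting and convertibility under substitutions and contexts *)

Lemma rewrite_rule R sigma l r :
  R (l, r) -> rewrite R (subst sigma l) (subst sigma r).
Proof.
move=> Rlr; exists [::], l, r, sigma.
by rewrite subterm_at_nil replace_at_nil.
Qed.

Lemma rewrite_replace_at R t p s u v : subterm_at t p = Some s ->
  rewrite R u v -> rewrite R (replace_at t p u) (replace_at t p v).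
Proof.
move=> ts [q [l [r [sigma [Rlr uq ->]]]]]; exists (p ++ q), l, r, sigma.
by rewrite (subterm_at_replace_at_cat _ _ _ _ _ ts)
           (replace_at_replace_at_cat _ _ _ _ _ _ ts).
Qed.

Lemma rewrite_subst R sigma s t :
  rewrite R s t -> rewrite R (subst sigma s) (subst sigma t).
Proof.
move=> [p [l [r [tau [Rlr sp ->]]]]].
exists p, l, r, (fun x => subst sigma (tau x)); split=> //.
  by rewrite (subterm_at_subst _ _ _ _ sp) subst_comp.
by rewrite (subst_replace_at _ _ _ _ _ sp) subst_comp.
Qed.

Lemma rewrite_subset R S s t : R `<=` S -> rewrite R s t -> rewrite S s t.
Proof.
by move=> RS [p [l [r [sigma [/RS]]]]]; exists p, l, r, sigma.
Qed.

(** Convertibility in [S] is itself an equivalence, so checking single steps suffices. It serves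
    with [g] a substitution, a context, or the identity when the system changes. *)
Lemma convertible_morph R S (g : term ar V -> term ar V) :
  (forall s t, rewrite R s t -> convertible S (g s) (g t)) ->
  forall s t, convertible R s t -> convertible S (g s) (g t).
Proof.
move=> step s t; elim=> {s t} [s t /step //|s|s t _|s t u _ st _].
- exact: rst_refl.
- exact: rst_sym.
- exact: rst_trans.
Qed.

Lemma convertible_subst R sigma s t :
  convertible R s t -> convertible R (subst sigma s) (subst sigma t).
Proof.
by apply: convertible_morph => {}s {}t st; apply: rst_step; apply: rewrite_subst.
Qed.

Lemma convertible_replace_at R t p s u : subterm_at t p = Some s ->
  convertible R s u -> convertible R t (replace_at t p u).
Proof.
move=> ts; rewrite -{1}(replace_at_id _ _ _ ts).
apply: (convertible_morph R R (replace_at t p)) => a b ab.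
by apply: rst_step; apply: rewrite_replace_at ts _.
Qed.

Lemma rewrites_convertible R s t : rewrites R s t -> convertible R s t.
Proof. exact: clos_rt_clos_rst. Qed.

(** * Confluence, normal forms and critical pairs *)

Lemma confluent_convertible_joinable R s t : confluent R -> convertible R s t ->
  exists2 u, rewrites R s u & rewrites R t u.
Proof.
move=> conf; elim=> {s t} [s t st|s|s t _ [u]|s t u _ [a sa ta] _ [b tb ub]].
- by exists t; [apply: rt_step|apply: rt_refl].
- by exists s; apply: rt_refl.
- by exists u.
(* The two valleys meet in a peak at the middle term [t], which confluence closes. *)
- have [c ac bc] := conf _ _ _ ta tb.
  by exists c; [apply: rt_trans ac|apply: rt_trans bc].
Qed.

Lemma NF_rewrites R s t : NF R s -> rewrites R s t -> s = t.
Proof.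
move=> + st; elim: st => {s t} [s t st nf|//|s t u _ IH1 _ IH2 nf].
  by case: nf; exists t.
by have st := IH1 nf; rewrite st; apply: IH2; rewrite -st.
Qed.

Lemma confluent_UNC R : confluent R -> UNC R.
Proof.
move=> conf u v nfu nfv /(confluent_convertible_joinable _ _ _ conf) [w uw vw].
by rewrite (NF_rewrites _ _ _ nfu uw) (NF_rewrites _ _ _ nfv vw).
Qed.

Lemma NF_Var R x : is_trs R -> NF R (Var ar x).
Proof.
move=> [_ trs] [t [p [l [r [sigma [/trs [nvar _]]]]]]].
by case: p => //=; case: l nvar.
Qed.

Lemma NF_rename R (rho : V -> V) t : bijective rho -> NF R t -> NF R (rename rho t).
Proof.
(* A step from the renamed term, renamed back by the inverse, is a step from [t]. *)
move=> [rho' rhoK _] nft [u red]; apply: nft; exists (rename rho' u).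
by rewrite -(renameK _ _ rhoK t); apply: rewrite_subst.
Qed.

(** Both sides are one-step reducts of [subst sigma (rename rho2 l2)]: the second rule applies at
    the root, and the first at [p] because [sigma] unifies. *)
Lemma critical_pair_convertible R c : critical_pair R c -> convertible R c.1 c.2.
Proof.
move=> [l1 [r1 [l2 [r2 [rho1 [rho2 [p [s [sigma
  [[R1 R2 _ _] [[_ sp _ _ [unif _]] ->]]]]]]]]]]] /=.
apply: (rst_trans _ _ _ (subst sigma (rename rho2 l2))); last first.
  by apply: rst_step; apply: rewrite_subst; apply: rewrite_rule.
rewrite (subst_replace_at _ _ _ _ _ sp); apply: rst_sym.
apply: convertible_replace_at (subterm_at_subst _ _ _ _ sp) _.
rewrite -[subst sigma s]unif; apply: rst_step.
by apply: rewrite_subst; apply: rewrite_rule.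
Qed.

(** * Exchange of variables *)

Lemma exists_fresh (D : set V) :
  infinite_set [set: V] -> finite_set D -> exists y, ~ D y.
Proof.
move=> Vinf Dfin; apply: contrapT => /forallNP Dall; apply: Vinf.
by apply: sub_finite_set Dfin => y _; apply: contrapT => /Dall.
Qed.

Lemma exists_transposition (x y : V) : exists rho : V -> V,
  [/\ bijective rho, rho x = y & forall z, z <> x -> z <> y -> rho z = z].
Proof.
pose rho z := if `[< z = x >] then y else if `[< z = y >] then x else z.
have rhox : rho x = y by rewrite /rho; case: asboolP.
have rhoy : rho y = x by rewrite /rho; do 2![case: asboolP => //].
have rhoz z : z <> x -> z <> y -> rho z = z.
  by move=> zx zy; rewrite /rho; do 2![case: asboolP => //].
(* The swap is its own inverse. *)
exists rho; split=> //; exists rho => z;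
  case: (EM (z = x)) => [->|zx]; rewrite ?rhox ?rhoy //;
  by case: (EM (z = y)) => [->|zy]; rewrite ?rhoy ?rhox ?rhoz.
Qed.

Lemma UNC_vars_NF R u v : infinite_set [set: V] -> UNC R ->
  convertible R u v -> NF R v -> vars v `<=` vars u.
Proof.
move=> Vinf unc uv nfv x vx; apply: contrapT => ux.
(* Freshness for [u] makes the swap of [x] and [y] fix [u]; freshness for [v] makes the renamed [v]
   differ from [v]. *)
have [y] : exists y, ~ (vars u `|` vars v) y.
  by apply: exists_fresh => //; rewrite finite_setU; split; apply: finite_vars.
move=> /not_orP[uy vy].
have [rho [rho_bij rhox rho_id]] := exists_transposition x y.
have rhou : rename rho u = u.
  rewrite -[RHS]subst_Var; apply: eq_in_subst => z uz.
  by rewrite rho_id // => zE; [apply: ux|apply: uy]; rewrite -zE.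
(* UNC would identify [v] with its renaming, in which [y] occurs as the image of [x]. *)
apply: vy; rewrite (unc v (rename rho v)) //; last 2 first.
- exact: NF_rename.
- apply: (rst_trans _ _ _ u); first exact: rst_sym.
  by rewrite -{1}rhou; apply: convertible_subst.
by rewrite vars_rename; exists x.
Qed.

(** * Extensions by sound rules *)

(** The three conditions respectively preserve the normal forms, the variable condition on rules,
    and convertibility. The first also excludes variables as left-hand sides. *)
Definition sound_rules R S : Prop :=
  forall l r, S (l, r) -> [/\ ~ NF R l, vars r `<=` vars l & convertible R l r].

Lemma sound_rules0 R : sound_rules R set0.
Proof. by []. Qed.

Lemma sound_rules1 R l r : ~ NF R l -> vars r `<=` vars l ->
  convertible R l r -> sound_rules R [set (l, r)].
Proof. by move=> nfl rl lr _ _ [-> ->]. Qed.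

Lemma sound_rulesU R S T :
  sound_rules R S -> sound_rules R T -> sound_rules R (S `|` T).
Proof. by move=> RS RT l r [/RS|/RT]. Qed.

Section SoundExtension.
Context {R S : set (rule ar V)} (RS : sound_rules R S).

Lemma is_trs_setU : is_trs R -> finite_set S -> is_trs (R `|` S).
Proof.
move=> Rtrs Sfin; split; first by rewrite finite_setU; split=> //; case: Rtrs.
move=> l r [|/RS[nfl rl _]]; first by case: Rtrs => _; apply.
by split=> //; case: l nfl {rl} => // x []; apply: NF_Var.
Qed.

Lemma NF_setU : NF (R `|` S) = NF R.
Proof.
apply/seteqP; split=> t nft [u]; last first.
  move=> [p [l [r [sigma [Rlr tp uE]]]]].
  case: Rlr => [Rlr|/RS[nfl _ _]]; first by apply: nft; exists u, p, l, r, sigma.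
  (* Where an added rule applies, [t] contains an instance of its left-hand side [l], and an
     [R]-step from [l] to [l'] can be performed there instead. *)
  apply: nfl => -[l' ll']; apply: nft; exists (replace_at t p (subst sigma l')).
  rewrite -{1}(replace_at_id _ _ _ tp).
  by apply: rewrite_replace_at tp _; apply: rewrite_subst.
by move=> tu; apply: nft; exists u; apply: rewrite_subset tu; apply: subsetUl.
Qed.

Lemma convertible_setU s t : convertible (R `|` S) s t <-> convertible R s t.
Proof.
split; apply: (convertible_morph _ _ id) => {}s {}t.
  move=> [p [l [r [sigma [Rlr sp ->]]]]].
  apply: convertible_replace_at sp _; apply: convertible_subst.
  case: Rlr => [Rlr|/RS[]//].
  by rewrite -(subst_Var l) -(subst_Var r); apply/rst_step/rewrite_rule.
by move=> st; apply/rst_step/(rewrite_subset _ _ _ _ _ st); apply: subsetUl.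
Qed.

Lemma UNC_setU : UNC (R `|` S) <-> UNC R.
Proof.
rewrite /UNC NF_setU; split=> unc u v nfu nfv uv; apply: unc => //;
  exact/convertible_setU.
Qed.

End SoundExtension.

(** * Soundness of the procedure *)

(** An exit comes from two distinct convertible normal forms or contradicts [UNC_vars_NF]. A rule
    added after a search is sound because [w] is a reduct of the other side of the pair. *)
Lemma process_sound (Phi : term ar V -> term ar V -> Prop) R u v res :
  infinite_set [set: V] -> convertible R u v -> process Phi R u v res ->
  if res is Some A then finite_set A /\ sound_rules R A else ~ UNC R.
Proof.
move=> Vinf uv; have vu := rst_sym _ _ _ _ uv.
case=> [_|neq _ nfu nfv|_ _ _ nfv Nsub|_ _ nfu _ sub|_ _ _ nfu Nsub
       |_ _ nfv _ sub|w _ _ _ nfv uw sub|w _ _ nfu _ vw sub|_ _ _ _].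
- by split; [exact: finite_set0|exact: sound_rules0].
- by move=> unc; apply: neq; apply: unc.
- by move=> unc; apply: Nsub; apply: UNC_vars_NF uv nfv.
- by split; [exact: finite_set1|exact: sound_rules1].
- by move=> unc; apply: Nsub; apply: UNC_vars_NF vu nfu.
- by split; [exact: finite_set1|exact: sound_rules1].
- split; [exact: finite_set1|apply: sound_rules1 => //].
  by apply: rst_trans vu _; apply: rewrites_convertible.
- split; [exact: finite_set1|apply: sound_rules1 => //].
  by apply: rst_trans uv _; apply: rewrites_convertible.
- by split; [exact: finite_set0|exact: sound_rules0].
Qed.

Lemma loop_sound (Phi : term ar V -> term ar V -> Prop) R C S res :
  infinite_set [set: V] -> loop Phi R C S res ->
  (forall u v, C (u, v) -> convertible R u v) ->
  finite_set S -> sound_rules R S ->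
  if res is Some A then finite_set A /\ sound_rules R A else ~ UNC R.
Proof.
move=> Vinf; elim=> {C S res} [//|C S u v Cuv puv conv _ _|].
  exact: (process_sound _ _ _ _ _ Vinf (conv _ _ Cuv) puv).
move=> C S u v A res Cuv puv _ IH conv Sfin RS.
have [Afin RA] := process_sound _ _ _ _ _ Vinf (conv _ _ Cuv) puv.
apply: IH => [u' v' [/conv]//||]; first by rewrite finite_setU.
exact: sound_rulesU.
Qed.

(** Induction on the run. [is_trs R] stands after the run so that the induction hypothesis can be
    applied to the extended system. *)
Lemma returns_sound CP (phi : set (rule ar V) -> Prop)
    (Phi : term ar V -> term ar V -> Prop) R o :
  infinite_set [set: V] -> computes_critical_pairs CP ->
  (forall S, is_trs S -> phi S ->
     (forall u v, CP S (u, v) -> Phi u v) -> confluent S) ->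
  returns CP phi Phi R o -> is_trs R ->
  match o with
  | ReturnUNC => UNC R
  | ReturnNotUNC => ~ UNC R
  | ReturnFailure => True
  end.
Proof.
move=> Vinf CP_spec criterion.
have CP_conv S u v : is_trs S -> CP S (u, v) -> convertible S u v.
  by move=> /CP_spec[_ CPS _] /CPS /critical_pair_convertible.
elim=> {R o} [R [PhiR phiR] Rtrs|R _ run Rtrs|//|R S o _ run _ _ IH Rtrs].
- by apply: confluent_UNC; apply: criterion.
- apply: (loop_sound _ _ _ _ _ Vinf run (fun u v => CP_conv R u v Rtrs)).
    exact: finite_set0.
  exact: sound_rules0.
have [Sfin RS] := loop_sound _ _ _ _ _ Vinf run
  (fun u v => CP_conv R u v Rtrs) (finite_set0 _) (sound_rules0 R).
have := IH (is_trs_setU RS Rtrs Sfin).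
(* The verdict on the extended system is carried back to [R]. *)
by case: o {IH} => //; rewrite (propext (UNC_setU RS)).
Qed.

End TermRewriting.

Theorem theorem5 (F : Type) (ar : F -> nat) (V : Type)
    (V_infinite : infinite_set [set: V])
    (CP : set (rule ar V) -> set (term ar V * term ar V))
    (CP_spec : computes_critical_pairs CP)
    (phi : set (rule ar V) -> Prop) (Phi : term ar V -> term ar V -> Prop)
    (criterion : forall S : set (rule ar V), is_trs S -> phi S ->
       (forall u v, CP S (u, v) -> Phi u v) -> confluent S)
    (R0 : set (rule ar V)) (R0_trs : is_trs R0) :
  (returns CP phi Phi R0 ReturnUNC -> UNC R0) /\
  (returns CP phi Phi R0 ReturnNotUNC -> ~ UNC R0).
Proof.
by split=> run;
  exact: (returns_sound _ _ _ _ _ V_infinite CP_spec criterion run R0_trs).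
Qed.
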